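(* Let $m$ be a positive integer, let $r\ge0$, let $\alpha>0$, and let $\lambda$ be a nonzero real number. Let $X$ be a Poisson random variable with parameter $\frac{\alpha}{m}$. Then for every integer $n\ge0$, $$E[(mX+m)_{n,\lambda}]=D^{(m)}_{m,\lambda}(n,\alpha)=\sum_{k=0}^nC_k\Big(1;-\frac{\alpha}{m}\Big)m^n\,S_{2,\frac{\lambda}{m}}(n,k),$$ and moreover $$D^{(r)}_{m,\lambda}(n,\alpha)=E[(mX+r)_{n,\lambda}]=\sum_{j=0}^nC_j\Big(1;-\frac{\alpha}{m}\Big)\sum_{k=j}^n\binom{n}{k}(r-m)_{n-k,\lambda}\,S_{2,\frac{\lambda}{m}}(k,j)\,m^k.$$
   Context: For real $x$ and nonzero real $\mu$, $(x)_{0,\mu}=1$, $(x)_{n,\mu}=x(x-\mu)\cdots(x-(n-1)\mu)$ for $n\ge1$; $(x)_0=1$, $(x)_k=x(x-1)\cdots(x-k+1)$. The degenerate Stirling numbers of the second kind are defined by $(x)_{n,\mu}=\sum_{k=0}^nS_{2,\mu}(n,k)(x)_k$ (and are $0$ for $k>n$). The Charlier polynomials $C_n(x;\beta)$ are defined by $e^{-\beta t}(1+t)^x=\sum_{n\ge0}C_n(x;\beta)\frac{t^n}{n!}$. For $s\ge0$, the degenerate $s$-Whitney numbers of the second kind $W^{(s)}_{m,\lambda}(n,k)$ are defined by $(mx+s)_{n,\lambda}=\sum_{k=0}^nW^{(s)}_{m,\lambda}(n,k)m^k(x)_k$, and the degenerate $s$-Dowling polynomials by $D^{(s)}_{m,\lambda}(n,x)=\sum_{k=0}^nW^{(s)}_{m,\lambda}(n,k)x^k$;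 equivalently $e_\lambda^s(t)e^{\frac{x}{m}(e_\lambda^m(t)-1)}=\sum_nD^{(s)}_{m,\lambda}(n,x)\frac{t^n}{n!}$ with $e_\lambda^x(t)=(1+\lambda t)^{x/\lambda}$. *)

(* Defs.v *)
From HB Require Import structures.
From mathcomp Require Import all_boot all_order all_algebra.
From mathcomp Require Import all_classical all_reals all_analysis.

Set Implicit Arguments.
Unset Strict Implicit.
Unset Printing Implicit Defensive.

Import Order.TTheory GRing.Theory Num.Theory.
Import numFieldNormedType.Exports.

Local Open Scope classical_set_scope.
Local Open Scope ring_scope.

Definition dfalling (R : realType) (x mu : R) (n : nat) : R :=
  \prod_(i < n) (x - i%:R * mu).

Definition falling (R : realType) (x : R) (k : nat) : R :=
  \prod_(i < k) (x - i%:R).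

(* Below, [get A] is used as a definite description: in each case the set A
   has exactly one element (for [whitney2], provided 0 < m). *)

Definition is_stirling2 (R : realType) (mu : R) (S : nat -> nat -> R) : Prop :=
  (forall (n : nat) (x : R),
     dfalling x mu n = \sum_(k < n.+1) S n k * falling x k) /\
  (forall n k : nat, (n < k)%N -> S n k = 0).

Definition stirling2 (R : realType) (mu : R) : nat -> nat -> R :=
  get [set S | is_stirling2 mu S].

(* The identity between the generating function and its series
   is required for t in a neighbourhood of 0, where (1 + t)^x is analytic;
   this determines the coefficients. *)
Definition is_charlier (R : realType) (x beta : R) (C : nat -> R) : Prop :=
  \forall t \near (0 : R),
    pseries (fun n => C n / n`!%:R) t @ \oo
      --> expR (- beta * t) * (1 + t) `^ x.

Definition charlier (R : realType) (n : nat) (x beta : R) : R :=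
  get [set C | is_charlier x beta C] n.

(* The values for k > n, which the defining identity
   leaves free, are set to 0. *)
Definition is_whitney2 (R : realType) (m : nat) (lambda s : R)
    (W : nat -> nat -> R) : Prop :=
  (forall (n : nat) (x : R),
     dfalling (m%:R * x + s) lambda n =
     \sum_(k < n.+1) W n k * m%:R ^+ k * falling x k) /\
  (forall n k : nat, (n < k)%N -> W n k = 0).

Definition whitney2 (R : realType) (m : nat) (lambda s : R) :
    nat -> nat -> R :=
  get [set W | is_whitney2 m lambda s W].

Definition dowling (R : realType) (m : nat) (lambda s : R) (n : nat) (x : R) :
    R :=
  \sum_(k < n.+1) whitney2 m lambda s n k * x ^+ k.

(* As the probabilities of the values k : nat add up to 1, this forces X to be
   almost surely a natural number.  [poisson_pmf] is the Poisson mass function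
   only for a positive rate. *)
Definition poisson_rv (d : measure_display) (T : measurableType d)
    (R : realType) (P : probability T R) (X : {RV P >-> R}) (rate : R) : Prop :=
  0 < rate /\ forall k : nat, pmf X k%:R = poisson_pmf rate k.

(* Main.v *)
(* If X is Poisson of parameter b, then E[(X)_k] = b^k.  Expanding (mX + s)_{n,lambda}
   in the basis m^k (X)_k thus gives the Dowling polynomial.  On the other hand
   (x + 1)_k = (x)_k + k (x)_{k-1}, so E[(X + 1)_k] = b^k + k b^{k-1}, which is
   C_k(1; -b), the coefficient of t^k/k! in e^{bt} (1 + t).  The Charlier
   expansions follow from m X + m = m (X + 1), and for general r from the
   Vandermonde convolution applied to (r - m) + (m X + m). *)
Require Import Defs.
From HB Require Import structures.
From mathcomp Require Import all_boot all_order all_algebra.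
From mathcomp Require Import all_classical all_reals all_analysis.
From mathcomp Require Import measurable_realfun ring lra.

Import Order.TTheory GRing.Theory Num.Theory.
Import numFieldNormedType.Exports.

Local Open Scope classical_set_scope.
Local Open Scope ring_scope.

(** * Algebra of falling factorials, and existence of the Stirling and Whitney numbers *)

Section falling_algebra.
Context {R : realType}.
Implicit Types (x y a mu s : R) (n k : nat).

Lemma dfalling0 x mu : dfalling x mu 0 = 1.
Proof. by rewrite /dfalling big_ord0. Qed.

Lemma dfallingS x mu n : dfalling x mu n.+1 = dfalling x mu n * (x - n%:R * mu).
Proof. by rewrite /dfalling big_ord_recr. Qed.

Lemma falling0 x : falling x 0 = 1.
Proof. by rewrite /falling big_ord0. Qed.

Lemma fallingS x k : falling x k.+1 = falling x k * (x - k%:R).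
Proof. by rewrite /falling big_ord_recr. Qed.

Lemma falling_nat n k : falling (n%:R : R) k = (n ^_ k)%:R.
Proof.
elim: k => [|k IHk]; first by rewrite falling0 ffactn0.
rewrite fallingS IHk ffactnSr natrM.
have [kn|nk] := leqP k n; first by rewrite natrB.
by rewrite ffact_small// !mul0r.
Qed.

(** Discrete analogue of the derivative of a power. At [k = 0] the truncated index [k.-1] is
    harmless, since its factor [k] is 0. *)
Lemma falling_addn1 x k :
  falling (x + 1) k = falling x k + k%:R * falling x k.-1.
Proof.
elim: k => [|[|k] IHk]; first by rewrite !falling0 mul0r addr0.
  by rewrite !fallingS !falling0; ring.
rewrite fallingS IHk /= (fallingS x k.+1) (fallingS x k).
by rewrite -!natr1; ring.
Qed.

Lemma dfalling_scale a x mu n : a != 0 ->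
  dfalling (a * x) mu n = a ^+ n * dfalling x (mu / a) n.
Proof.
move=> a0; elim: n => [|n IHn]; first by rewrite !dfalling0 mul1r.
by rewrite !dfallingS IHn exprS; field.
Qed.

(** Vandermonde convolution with step [mu], by induction on [n]. *)
Lemma dfallingD x y mu n :
  dfalling (x + y) mu n =
  \sum_(k < n.+1) 'C(n, k)%:R * dfalling x mu (n - k) * dfalling y mu k.
Proof.
elim: n => [|n IHn].
  by rewrite big_ord_recl big_ord0 !dfalling0 bin0 !mul1r addr0.
rewrite dfallingS IHn mulr_suml.
(* The new factor x + y - n mu splits as (x - (n - k) mu) + (y - k mu), so each term extends one of
   its two products. *)
transitivity (\sum_(k < n.+1) ('C(n, k)%:R * dfalling x mu (n.+1 - k) *
    dfalling y mu k) + \sum_(k < n.+1) ('C(n, k)%:R * dfalling x mu (n - k) *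
    dfalling y mu k.+1)).
  rewrite -big_split /=; apply: eq_bigr => -[k kn] _ /=.
  rewrite subSn// !dfallingS natrB//; ring.
rewrite big_ord_recl [X in _ + X = _]big_ord_recr /= [RHS]big_ord_recl /=.
rewrite [X in _ = _ + X]big_ord_recr /= !bin0 !subn0 !binn !subnn -!addrA.
congr (_ + _); rewrite !addrA; congr (_ + _).
(* With the two extreme terms matched, the inner ones agree by Pascal's rule. *)
rewrite -big_split /=; apply: eq_bigr => i _.
by rewrite /bump /= !add1n !subSS binS natrD; ring.
Qed.

(* Comes from [(x)_k (a x + s - n mu) = a (x)_{k+1} + (a k + s - n mu) (x)_k]. *)
Fixpoint whitney_rec a mu s n k : R :=
  if n is n'.+1 then
    (if k is k'.+1 then whitney_rec a mu s n' k' else 0) +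
    (a * k%:R + s - n'%:R * mu) * whitney_rec a mu s n' k
  else (k == 0)%:R.

Lemma whitney_rec_gt a mu s n k : (n < k)%N -> whitney_rec a mu s n k = 0.
Proof.
elim: n k => [|n IHn] [|k]//= nk.
by rewrite !IHn ?mulr0 ?addr0// ltnW.
Qed.

Lemma whitney_recP a mu s n x :
  dfalling (a * x + s) mu n =
  \sum_(k < n.+1) whitney_rec a mu s n k * a ^+ k * falling x k.
Proof.
elim: n => [|n IHn].
  by rewrite big_ord_recl big_ord0 dfalling0 falling0 /= !mul1r addr0.
rewrite dfallingS IHn mulr_suml.
(* The two sums mirror the two summands of the recurrence. The second one gets an extra term
   [k = n.+1], which is zero, so that both fit the target range. *)
transitivity (\sum_(k < n.+1) (whitney_rec a mu s n k * a ^+ k.+1 *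
    falling x k.+1) + \sum_(k < n.+2) ((a * k%:R + s - n%:R * mu) *
    whitney_rec a mu s n k * a ^+ k * falling x k)).
  rewrite [X in _ = _ + X]big_ord_recr /= whitney_rec_gt// mulr0 !mul0r addr0.
  rewrite -big_split /=; apply: eq_bigr => k _.
  by rewrite fallingS exprS; ring.
rewrite [RHS]big_ord_recl [X in _ + X = _]big_ord_recl /= add0r addrCA; congr (_ + _).
rewrite -big_split /=; apply: eq_bigr => k _.
by rewrite /bump /= !add1n; ring.
Qed.

(** [get] satisfies its specification once a witness exists; the recurrence with [a = 1] and [s = 0]
    is one. *)
Lemma stirling2P mu : is_stirling2 mu (stirling2 mu).
Proof.
apply: (@getPex _ [set S | is_stirling2 mu S]).
exists (whitney_rec 1 mu 0); split; last exact: whitney_rec_gt.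
move=> n x; rewrite -[x in LHS]mul1r -[X in dfalling X]addr0 whitney_recP.
by apply: eq_bigr => k _; rewrite expr1n mulr1.
Qed.

Lemma whitney2P (m : nat) mu s : is_whitney2 m mu s (whitney2 m mu s).
Proof.
apply: (@getPex _ [set W | is_whitney2 m mu s W]).
exists (whitney_rec m%:R mu s); split; last exact: whitney_rec_gt.
by move=> n x; exact: whitney_recP.
Qed.

End falling_algebra.

(** * Uniqueness of power series coefficients, and the Charlier values at 1 *)

Section charlier_one.
Context {R : realType}.
Implicit Types (c : nat -> R) (b t : R).

Lemma pseries_recl c t k :
  pseries c t k.+1 = c 0 + t * pseries (fun i => c i.+1) t k.
Proof.
rewrite /pseries /series /= big_nat_recl// expr0 mulr1; congr (_ + _).
by rewrite mulr_sumr; apply: eq_bigr => i _; rewrite exprS; ring.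
Qed.

(** Near 0 the partial sums are [c 0] plus t times a bounded quantity, so they can tend to 0 only if
    [c 0] is 0. *)
Lemma pseries_cvg0_coef0 c :
  (\forall t \near 0^', pseries c t @ \oo --> (0 : R)) -> c 0 = 0.
Proof.
move=> /nbhs_ballP[e /= e0 ce].
have cvg0 t : `|t| < e -> t != 0 -> pseries c t @ \oo --> (0 : R).
  by move=> te t0; apply: ce; rewrite // -ball_normE /= sub0r normrN.
(* The shifted series converges at e/2, its partial sums being those of [c] minus [c 0], divided by
   e/2. *)
pose c' i := c i.+1.
have cvgc' : cvgn (pseries c' (e / 2)).
  have e20 : e / 2 != 0 by rewrite gt_eqF// divr_gt0.
  have : pseries c (e / 2) @ \oo --> (0 : R).
    by apply: cvg0 => //; rewrite gtr0_norm; lra.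
  rewrite -cvg_shiftS => cvgc; apply/cvg_ex; exists ((e / 2)^-1 * (0 - c 0)).
  rewrite [X in X @ _ --> _](_ : _ =
    fun k => (e / 2)^-1 * (pseries c (e / 2) k.+1 - c 0)).
    by apply: cvgMr; apply: cvgB => //; exact: cvg_cst.
  by apply/funext => k; rewrite pseries_recl addrAC subrr add0r mulKf.
(* Strictly inside e/2 the convergence is absolute; this yields a bound [M] on the partial sums that
   is uniform in 0 < t <= e/4. *)
have : cvgn (pseries (fun i => `|c' i|) (e / 4)).
  by apply: is_cvg_pseries_inside_norm cvgc' _; rewrite !gtr0_norm; lra.
move=> /cvg_seq_bounded[M0 [_ /(_ (`|M0| + 1))]].
have -> : M0 < `|M0| + 1 by rewrite (le_lt_trans (ler_norm _))// ltrDl.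
move=> /(_ isT); set M := `|M0| + 1 => Mub.
have M_gt0 : 0 < M by rewrite /M ltr_wpDl.
have bnd t k : 0 < t -> t <= e / 4 -> `|pseries c' t k| <= M.
  move=> t0 te; apply: le_trans (Mub k Logic.I).
  rewrite /pseries /series /= (le_trans (ler_norm_sum _ _ _))//.
  rewrite (le_trans _ (ler_norm _))//; apply: ler_sum => i _.
  rewrite normrM ler_wpM2l// normrX (gtr0_norm t0).
  by rewrite lerXn2r// nnegrE; lra.
apply/eqP; apply: contraT; rewrite -normr_gt0 => c0.
(* The first bound makes [bnd] applicable. The second keeps the tail below |c 0| / 2, so the partial
   sums stay at least |c 0| / 2 away from 0. *)
pose t := Num.min (e / 4) (`|c 0| / 2 / M).
have t0 : 0 < t by rewrite lt_min !divr_gt0//.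
have te : t <= e / 4 by rewrite ge_min lexx.
have tc : t * M <= `|c 0| / 2 by rewrite -ler_pdivlMr// ge_min lexx orbT.
have : pseries c t @ \oo --> (0 : R).
  by apply: cvg0; rewrite ?gt_eqF// gtr0_norm//; lra.
rewrite -cvg_shiftS => /cvgrPdist_lt /(_ (`|c 0| / 2)).
rewrite divr_gt0// => /(_ isT)[k _ /(_ k (leqnn k))] /=.
rewrite pseries_recl sub0r normrN => H.
have := bnd t k t0 te; rewrite -(ler_pM2l t0) => H'.
have : `|c 0| <= `|c 0 + t * pseries c' t k| + `|t * pseries c' t k|.
  by rewrite -{1}(addrK (t * pseries c' t k) (c 0)) (le_trans (ler_normB _ _)).
rewrite [X in _ + X]normrM (gtr0_norm t0) => H''.
by lra.
Qed.

(** Once [c 0] is 0, dividing by t gives the same hypothesis for the shifted sequence. The punctured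
    neighbourhood makes this division legitimate. *)
Lemma pseries_cvg0_coef c :
  (\forall t \near 0^', pseries c t @ \oo --> (0 : R)) -> forall n, c n = 0.
Proof.
move=> c0 n; elim: n c c0 => [|n IHn] c c0; first exact: pseries_cvg0_coef0.
apply: (IHn (fun i => c i.+1)).
have c00 := pseries_cvg0_coef0 c c0.
near=> t.
have tn0 : t != 0 by near: t; exact: nbhs_dnbhs_neq.
have : pseries c t @ \oo --> (0 : R) by near: t.
rewrite -cvg_shiftS => cvgc.
rewrite [X in X @ _ --> _](_ : _ = fun k => t^-1 * pseries c t k.+1).
  by rewrite -(mulr0 t^-1); exact: cvgMr.
by apply/funext => k; rewrite pseries_recl c00 add0r mulKf.
Unshelve. all: by end_near. Qed.

(** Needed to identify the sequence chosen by [get] with an explicit one: the difference of the two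
    series sums to 0 near 0. *)
Lemma is_charlier_unique x b C1 C2 :
  is_charlier x b C1 -> is_charlier x b C2 -> C1 = C2.
Proof.
move=> h1 h2; apply/funext => n.
have /(_ n)/= : forall n, C1 n / n`!%:R - C2 n / n`!%:R = 0.
  apply: (pseries_cvg0_coef (fun n => C1 n / n`!%:R - C2 n / n`!%:R)).
  apply: (@cvg_within _ (nbhs (0 : R))).
  near=> t.
  have : pseries (fun n => C1 n / n`!%:R) t @ \oo -->
    expR (- b * t) * (1 + t) `^ x by near: t.
  have : pseries (fun n => C2 n / n`!%:R) t @ \oo -->
    expR (- b * t) * (1 + t) `^ x by near: t.
  move=> c2 c1; have := cvgB c1 c2; rewrite subrr.
  suff -> : pseries (fun n => C1 n / n`!%:R) t -
      pseries (fun n => C2 n / n`!%:R) t =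
      pseries (fun n => C1 n / n`!%:R - C2 n / n`!%:R) t by apply.
  apply/funext => k; rewrite /pseries /series /= !fctE -sumrB.
  by apply: eq_bigr => i _; rewrite mulrBl.
rewrite -mulrBl => /eqP; rewrite mulf_eq0 invr_eq0 pnatr_eq0.
by rewrite gtn_eqF ?fact_gt0// orbF subr_eq0 => /eqP.
Unshelve. all: by end_near. Qed.

Lemma charlier1E b k : charlier k 1 (- b) = b ^+ k + k%:R * b ^+ k.-1.
Proof.
pose C k : R := b ^+ k + k%:R * b ^+ k.-1.
suff HC : is_charlier 1 (- b) C.
  rewrite /charlier.
  have := @getPex _ [set C | is_charlier 1 (- b) C] (ex_intro _ C HC).
  by move=> /is_charlier_unique/(_ HC) ->.
rewrite /is_charlier; near=> t.
(* For |t| < 1 the base is nonnegative, so its real power with exponent 1 is 1 + t itself. *)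
have t1 : 0 <= 1 + t.
  have : ball 0 1 t by near: t; exact: nbhsx_ballx.
  rewrite -ball_normE /= sub0r normrN.
  by rewrite ltr_norml => /andP[? _]; lra.
rewrite powRr1// opprK -cvg_shiftS.
have cvg_exp : series (exp_coeff (b * t)) @ \oo --> expR (b * t).
  exact: is_cvg_series_exp_coeff.
(* Multiplication by 1 + t is exact on partial sums: with S_k those of exp(b t), the series of [C]
   has partial sum S_{k+1} + t S_k at order k + 1. *)
rewrite mulrDr mulr1 [X in X @ _ --> _](_ : _ = fun k =>
  series (exp_coeff (b * t)) k.+1 + series (exp_coeff (b * t)) k * t).
  apply: cvgD; last by apply: cvgMl.
  by move: cvg_exp; rewrite -cvg_shiftS.
apply/funext => n; rewrite /pseries /series /exp_coeff /=.
rewrite !big_nat_recl// -addrA mulr_suml -big_split /= /C.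
congr (_ + _); first by rewrite !expr0 mul0r addr0 mulr1.
apply: eq_bigr => i _; rewrite factS natrM !exprMn !exprS.
have i0 : i`!%:R != 0 :> R by rewrite pnatr_eq0 -lt0n fact_gt0.
have i1 : i.+1%:R != 0 :> R by rewrite pnatr_eq0.
by field; rewrite i0 addrC natr1 i1.
Unshelve. all: by end_near. Qed.

End charlier_one.

(** * Linearity of expectation and factorial moments of a Poisson variable *)

Lemma expectation_lincomb {R : realType} {d} {T : measurableType d}
    {P : probability T R} (G : nat -> T -> R) (c a : nat -> R) n :
  (forall k, P.-integrable setT (EFin \o G k)) ->
  (forall k, 'E_P[G k] = (c k)%:E)%E ->
  'E_P[fun w => (\sum_(k < n) a k * G k w)%R]%E = (\sum_(k < n) a k * c k)%:E.
Proof.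
move=> intG EG; rewrite unlock -sumEFin.
under eq_integral do rewrite -sumEFin.
rewrite (integral_sum measurableT (f := fun (k : 'I_n) w => (a k * G k w)%:E));
    last first.
  by move=> k; under eq_fun do rewrite EFinM; exact: integrableZl (intG k).
apply: eq_bigr => k _; under eq_integral do rewrite EFinM.
rewrite integralZl ?EFinM//; last exact: intG.
by have := EG k; rewrite unlock => <-.
Qed.

Section poisson_expectation.
Context {R : realType} {d} {T : measurableType d} {P : probability T R}.
Context {X : {RV P >-> R}} {b : R} (poissonX : poisson_rv X b).
Local Open Scope ereal_scope.

Let A (k : nat) : set T := X @^-1` [set k%:R].

Let mA k : measurable (A k).
Proof. by apply: measurable_funPTI; exact: measurable_set1. Qed.

Let tA : trivIset setT A.
Proof.
apply/trivIsetP => i j _ _ ij; rewrite -preimage_setI.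
apply/seteqP; split => // t [/= -> /eqP].
by rewrite eqr_nat (negbTE ij).
Qed.

Let PA k : P (A k) = (poisson_pmf b k)%:E.
Proof.
have [_ /(_ k) <-] := poissonX.
by rewrite /pmf fineK// fin_num_measure.
Qed.

Let sum_poisson_pmf : \sum_(k <oo) (poisson_pmf b k)%:E = 1.
Proof.
have [b0 _] := poissonX.
transitivity (@poisson_prob R b 0%N setT); last exact: probability_setT.
rewrite /poisson_prob b0 -nneseries_esumT// => k.
by rewrite lee_fin poisson_pmf_ge0.
Qed.

Let PUA : P (\bigcup_k A k) = 1.
Proof.
rewrite measure_bigcup// -sum_poisson_pmf.
rewrite (eq_eseriesl (Q := xpredT)) => [|k]; last by rewrite in_setT.
by apply: eq_eseriesr => k _; exact: PA.
Qed.

(** The fibres [A k] over the naturals have total probability 1, so the complement of their union is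
    a null set. *)
Lemma poisson_rv_ae_nat (Q : R -> Prop) :
  (forall k : nat, Q k%:R) -> {ae P, forall w, Q (X w)}.
Proof.
move=> HQ; exists (~` \bigcup_k A k); split.
- exact/measurableC/bigcup_measurable.
- rewrite probability_setC; last exact: bigcup_measurable.
  by rewrite PUA subee.
- by move=> t /= nQ [k _ /= Xt]; apply: nQ; rewrite Xt.
Qed.

Lemma ge0_integral_poisson_rv (g : R -> \bar R) : measurable_fun setT g ->
  (forall x, 0 <= g x) ->
  \int[P]_w g (X w) = \sum_(k <oo) g k%:R * (poisson_pmf b k)%:E.
Proof.
move=> mg g0; have mUA : measurable (\bigcup_k A k) by exact: bigcup_measurable.
have mgX : measurable_fun setT (fun w => g (X w)) by exact: measurableT_comp.
have PN : P (~` \bigcup_k A k) = 0 by rewrite probability_setC// PUA subee.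
(* Dropping the null set leaves a disjoint union of fibres, on each of which the integrand is
   constant. *)
rewrite (ge0_negligible_integral (measurableC mUA) measurableT mgX _ PN)//.
rewrite setDE setTI setCK ge0_integral_bigcup//; last exact: measurable_funTS.
apply: eq_eseriesr => k _; transitivity (\int[P]_(x in A k) (cst (g k%:R) x)).
  by apply: eq_integral => w; rewrite inE => /= ->.
by rewrite integral_cst//; rewrite -PA.
Qed.

Lemma measurable_falling k : measurable_fun setT (fun x : R => falling x k).
Proof.
apply: measurable_prod => i _.
by apply: measurable_funB => //; exact: measurable_id.
Qed.

(** The absolute value lets one computation serve both for integrability and for the factorial
    moment. *)
Lemma integral_norm_falling_poisson_rv k :
  \int[P]_w `|falling (X w) k|%:E = (b ^+ k)%:E.
Proof.
have [b0 _] := poissonX.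
rewrite (@ge0_integral_poisson_rv (fun x => `|falling x k|%:E)) => [||x].
- pose f i := (`|falling i%:R k| * poisson_pmf b i)%R.
  rewrite (_ : \sum_(i <oo) _ = \sum_(i <oo) (f i)%:E)//.
  (* The terms with i < k vanish because (i)_k = 0; the remaining series is reindexed by i + k. *)
  rewrite (nneseries_split 0 k); last first.
    by move=> i _; rewrite lee_fin mulr_ge0// poisson_pmf_ge0.
  rewrite add0n big_nat big1 ?add0e; last first.
    by move=> i /andP[_ ik]; rewrite /f falling_nat ffact_small// normr0 mul0r.
  rewrite -nneseries_addn; last first.
    by move=> i; rewrite lee_fin mulr_ge0// poisson_pmf_ge0.
  (* Since (i + k)! = (i + k)_k i!, the factorial moment weight cancels and b^k factors out of the
     total mass. *)
  transitivity (\sum_(i <oo) (b ^+ k)%:E * (poisson_pmf b i)%:E).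
    apply: eq_eseriesr => i _; rewrite -EFinM /f falling_nat normr_nat; congr EFin.
    rewrite /poisson_pmf b0 -(ffact_fact (leq_addl i k)) addnK natrM exprD.
    have ? : i`!%:R != 0%R :> R by rewrite pnatr_eq0 -lt0n fact_gt0.
    have ? : ((i + k) ^_ k)%:R != 0%R :> R.
      by rewrite pnatr_eq0 -lt0n ffact_gt0 leq_addl.
    by field; apply/andP.
  rewrite nneseriesZl; last by move=> i _; rewrite lee_fin poisson_pmf_ge0.
  by rewrite sum_poisson_pmf mule1.
- apply/measurable_EFinP; apply: measurableT_comp => //.
  exact: measurable_falling.
- by rewrite lee_fin.
Qed.

Lemma measurable_falling_rv k : measurable_fun setT (fun w => falling (X w) k).
Proof. exact: (measurableT_comp (measurable_falling k)). Qed.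

Lemma integrable_falling_poisson_rv k :
  P.-integrable setT (fun w => (falling (X w) k)%:E).
Proof.
apply/integrableP; split; first exact/measurable_EFinP/measurable_falling_rv.
by rewrite integral_norm_falling_poisson_rv ltry.
Qed.

(** Almost surely X is a natural number, where the falling factorial is nonnegative and equals its
    absolute value. *)
Lemma expectation_falling_poisson_rv k :
  'E_P[fun w => falling (X w) k] = (b ^+ k)%:E.
Proof.
rewrite unlock; rewrite -integral_norm_falling_poisson_rv; apply: ae_eq_integral => //.
- exact/measurable_EFinP/measurable_falling_rv.
- apply/measurable_EFinP; apply: measurableT_comp => //.
  exact: measurable_falling_rv.
- apply: filterS (poisson_rv_ae_nat
    (fun x => falling x k = `|falling x k|%R) _) => [w /= <-//|i].
  by rewrite falling_nat normr_nat.
Qed.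

Lemma integrable_falling_addn1_poisson_rv k :
  P.-integrable setT (fun w => (falling (X w + 1) k)%:E).
Proof.
under eq_fun do rewrite falling_addn1 EFinD EFinM.
apply: integrableD => //; first exact: integrable_falling_poisson_rv.
by apply: integrableZl => //; exact: integrable_falling_poisson_rv.
Qed.

Lemma expectation_falling_addn1_poisson_rv k :
  'E_P[fun w => falling (X w + 1) k] = (charlier k 1 (- b))%:E.
Proof.
have int i := integrable_falling_poisson_rv i.
rewrite unlock; under eq_integral do rewrite falling_addn1 EFinD EFinM.
rewrite integralD//; last exact: integrableZl.
rewrite integralZl//.
have E i := expectation_falling_poisson_rv i; rewrite unlock in E.
by rewrite !E charlier1E EFinD EFinM.
Qed.

End poisson_expectation.

(** * Dowling polynomials as Poisson expectations, and their Charlier expansions *)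

Section dowling_poisson.
Context {R : realType} {m : nat} (m_gt0 : (0 < m)%N) (lambda : R).

Let m_neq0 : m%:R != 0 :> R. Proof. by rewrite pnatr_eq0 -lt0n. Qed.

(** Taking m out of each of the n factors of (m (x + 1))_{n,lambda} turns the step lambda into
    lambda / m. *)
Lemma dfalling_stirling2 x n :
  dfalling (m%:R * x + m%:R) lambda n =
  \sum_(k < n.+1) m%:R ^+ n * stirling2 (lambda / m%:R) n k * falling (x + 1) k.
Proof.
have [S_dfalling _] := stirling2P (lambda / m%:R).
rewrite -[X in _ + X]mulr1 -mulrDr dfalling_scale// S_dfalling mulr_sumr.
by apply: eq_bigr => k _; rewrite mulrA.
Qed.

Lemma dfalling_shift_stirling2 s x n :
  dfalling (m%:R * x + s) lambda n =
  \sum_(j < n.+1) (\sum_(j <= k < n.+1) 'C(n, k)%:R *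
    dfalling (s - m%:R) lambda (n - k) * stirling2 (lambda / m%:R) k j *
    m%:R ^+ k) * falling (x + 1) j.
Proof.
have [_ S_gt] := stirling2P (lambda / m%:R).
have -> : m%:R * x + s = s - m%:R + (m%:R * x + m%:R) by ring.
rewrite dfallingD.
under eq_bigr => k _.
  rewrite dfalling_stirling2 mulr_sumr.
  (* The inner range j <= k is widened to j <= n under a condition, so that the two sums can be
     exchanged. *)
  rewrite (big_ord_widen n.+1 (fun j => 'C(n, k)%:R *
    dfalling (s - m%:R) lambda (n - k) * (m%:R ^+ k *
    stirling2 (lambda / m%:R) k j * falling (x + 1) j)))//.
  rewrite big_mkcond /=; over.
rewrite exchange_big /=; apply: eq_bigr => j _.
rewrite mulr_suml big_geq_mkord [RHS]big_mkcond /=; apply: eq_bigr => k _.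
by rewrite ltnS; case: ifP => // _; ring.
Qed.

Context {d} {T : measurableType d} {P : probability T R} {X : {RV P >-> R}}.
Context {alpha : R} (poissonX : poisson_rv X (alpha / m%:R)).

Lemma expectation_dfalling_dowling s n :
  'E_P[fun w => dfalling (m%:R * X w + s) lambda n]%E =
  (dowling m lambda s n alpha)%:E.
Proof.
have [W_dfalling _] := whitney2P m lambda s.
under eq_fun do rewrite W_dfalling.
rewrite (expectation_lincomb (fun k w => falling (X w) k)
  (fun k => (alpha / m%:R) ^+ k)
  (fun k => whitney2 m lambda s n k * m%:R ^+ k)) => [|k|k].
- congr EFin; apply: eq_bigr => k _.
  (* The factor m^k of the Whitney expansion cancels the denominator of (alpha / m)^k. *)
  by rewrite -mulrA -exprMn mulrCA divff// mulr1.
- exact: integrable_falling_poisson_rv poissonX k.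
- exact: expectation_falling_poisson_rv poissonX k.
Qed.

Lemma expectation_falling_addn1_charlier (a : nat -> R) n :
  'E_P[fun w => (\sum_(k < n) a k * falling (X w + 1) k)%R]%E =
  (\sum_(k < n) a k * charlier k 1 (- (alpha / m%:R)))%:E.
Proof.
apply: (expectation_lincomb (fun k w => falling (X w + 1) k)) => k.
- exact: integrable_falling_addn1_poisson_rv poissonX k.
- exact: expectation_falling_addn1_poisson_rv poissonX k.
Qed.

End dowling_poisson.

Theorem theorem10 (R : realType) (m : nat) (hm : (0 < m)%N)
    (r : R) (hr : 0 <= r) (alpha : R) (halpha : 0 < alpha)
    (lambda : R) (hlambda : lambda != 0)
    (d : measure_display) (T : measurableType d) (P : probability T R)
    (X : {RV P >-> R}) (hX : poisson_rv X (alpha / m%:R)) (n : nat) :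
  ('E_P[fun w => dfalling (m%:R * X w + m%:R) lambda n]%E =
     (dowling m lambda m%:R n alpha)%:E /\
   dowling m lambda m%:R n alpha =
     \sum_(k < n.+1) charlier k 1 (- (alpha / m%:R)) * m%:R ^+ n *
       stirling2 (lambda / m%:R) n k) /\
  ((dowling m lambda r n alpha)%:E =
     'E_P[fun w => dfalling (m%:R * X w + r) lambda n]%E /\
   'E_P[fun w => dfalling (m%:R * X w + r) lambda n]%E =
     (\sum_(j < n.+1) charlier j 1 (- (alpha / m%:R)) *
        \sum_(j <= k < n.+1) 'C(n, k)%:R * dfalling (r - m%:R) lambda (n - k) *
          stirling2 (lambda / m%:R) k j * m%:R ^+ k)%:E).
Proof.
split; split.
- exact: expectation_dfalling_dowling.
(* The purely numerical identity is obtained by evaluating the same expectation in two bases. *)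
- apply: EFin_inj; rewrite -(expectation_dfalling_dowling hm lambda hX).
  under eq_fun do rewrite dfalling_stirling2//.
  rewrite (expectation_falling_addn1_charlier hX
    (fun k => m%:R ^+ n * stirling2 (lambda / m%:R) n k)).
  by congr EFin; apply: eq_bigr => k _; ring.
- exact/esym/expectation_dfalling_dowling.
- under eq_fun do rewrite dfalling_shift_stirling2//.
  rewrite (expectation_falling_addn1_charlier hX (fun j =>
    \sum_(j <= k < n.+1) 'C(n, k)%:R * dfalling (r - m%:R) lambda (n - k) *
      stirling2 (lambda / m%:R) k j * m%:R ^+ k)).
  by congr EFin; apply: eq_bigr => j _; rewrite mulrC.
Qed.
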